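(* For a bivariate copula $C$, let $C_S=\frac{C+C^T}{2}$ denote its symmetrized copula. Then: (1) $M$ is the unique copula $C$ satisfying $C_S=M$. (2) $W$ is the unique copula $C$ satisfying $C_S=W$. (3) There are many copulas $C$ satisfying $C_S=\Pi$; that is, there exist copulas $C\neq \Pi$ with $C_S=\Pi$.
   Context: A (bivariate) copula is a function $C:[0,1]^2\to[0,1]$ such that, for all $u,v\in[0,1]$: (1) $C(0,v)=C(u,0)=0$; (2) $C(1,v)=v$ and $C(u,1)=u$; (3) for every rectangle $[u_1,u_2]\times[v_1,v_2]\subset[0,1]^2$ with $u_1<u_2$ and $v_1<v_2$, $C(u_2,v_2)-C(u_2,v_1)-C(u_1,v_2)+C(u_1,v_1)\ge 0$. The transpose of $C$ is $C^T(u,v)=C(v,u)$. The copulas $M$, $W$, $\Pi$ are $M(u,v)=\min(u,v)$, $W(u,v)=\max(u+v-1,0)$, $\Pi(u,v)=uv$. *)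

(* Defs.v *)
From mathcomp Require Import all_boot all_order all_algebra.
From mathcomp Require Import interval_inference reals.
From mathcomp Require Import lra.

Set Implicit Arguments.
Unset Strict Implicit.
Unset Printing Implicit Defensive.

Import Order.TTheory GRing.Theory Num.Theory.
Local Open Scope ring_scope.

(* [{i01 R}] is the closed unit interval [0, 1] of [R], as a type. *)
Notation bifun01 R := ({i01 R} -> {i01 R} -> {i01 R}).

Definition is_copula (R : realType) (C : bifun01 R) : Prop :=
  [/\ forall u v, C 0%:i01 v = 0%:i01 /\ C u 0%:i01 = 0%:i01,
      forall u v, C 1%:i01 v = v /\ C u 1%:i01 = u
    & forall u1 u2 v1 v2 : {i01 R}, u1%:num < u2%:num -> v1%:num < v2%:num ->
        0 <= (C u2 v2)%:num - (C u2 v1)%:num - (C u1 v2)%:num + (C u1 v1)%:num].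

Definition copula_transpose (R : realType) (C : bifun01 R) : bifun01 R :=
  fun u v => C v u.

Lemma half_sum_ge0 (R : realType) (x y : {i01 R}) :
  0 <= (x%:num + y%:num) / 2.
Proof. by rewrite divr_ge0 ?addr_ge0. Qed.

Lemma half_sum_le1 (R : realType) (x y : {i01 R}) :
  (x%:num + y%:num) / 2 <= 1.
Proof.
have hx : x%:num <= 1 by [].
have hy : y%:num <= 1 by [].
by lra.
Qed.

Definition symmetrized (R : realType) (C : bifun01 R) : bifun01 R :=
  fun u v =>
    Itv01 (half_sum_ge0 (C u v) (copula_transpose C u v))
          (half_sum_le1 (C u v) (copula_transpose C u v)).

Definition copula_M (R : realType) : bifun01 R :=
  fun u v => (Num.min u%:num v%:num)%:i01.

Lemma W_ge0 (R : realType) (u v : {i01 R}) :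
  0 <= Num.max (u%:num + v%:num - 1) 0.
Proof. by rewrite le_max lexx orbT. Qed.

Lemma W_le1 (R : realType) (u v : {i01 R}) :
  Num.max (u%:num + v%:num - 1) 0 <= 1.
Proof.
have hu : u%:num <= 1 by [].
have hv : v%:num <= 1 by [].
by rewrite ge_max ler01 andbT; lra.
Qed.

Definition copula_W (R : realType) : bifun01 R :=
  fun u v => Itv01 (W_ge0 u v) (W_le1 u v).

Definition copula_Pi (R : realType) : bifun01 R :=
  fun u v => (u%:num * v%:num)%:i01.

Arguments copula_M : clear implicits.
Arguments copula_W : clear implicits.
Arguments copula_Pi : clear implicits.

(* Main.v *)
Require Import Defs.
From mathcomp Require Import all_boot all_order all_algebra.
From mathcomp Require Import interval_inference reals.
From mathcomp Require Import boolp ring lra.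

(** [M] and [W] are the pointwise extremes of the set of copulas
    (Frechet-Hoeffding bounds), so a mean of two copulas can equal one of them
    only if both copulas do.  For the independence copula, add to [u v] the
    antisymmetric term [(f u g v - g u f v) / 2] with [f u = u (1 - u)] and
    [g u = u^2 (1 - u)]: both vanish at 0 and 1 and are 1-Lipschitz, which keeps
    all rectangle volumes nonnegative. *)

Set Implicit Arguments.
Unset Strict Implicit.
Unset Printing Implicit Defensive.

Import Order.TTheory GRing.Theory Num.Theory.
Local Open Scope ring_scope.

Section Copula.
Variable R : realType.
Implicit Types (C : bifun01 R) (u v : {i01 R}).

Let i0 : {i01 R} := 0%:i01.
Let i1 : {i01 R} := 1%:i01.

Lemma i01_ge0 u : 0 <= u%:num. Proof. by []. Qed.

Lemma i01_le1 u : u%:num <= 1. Proof. by []. Qed.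

Lemma bifun01_ext C D :
  (forall u v, (C u v)%:num = (D u v)%:num) -> C = D.
Proof. by move=> CD; apply/funext => u; apply/funext => v; exact/val_inj/CD. Qed.

Lemma symmetrizedE C u v :
  (symmetrized C u v)%:num = ((C u v)%:num + (C v u)%:num) / 2.
Proof. by []. Qed.

Lemma symmetrized_sym C : (forall u v, C u v = C v u) -> symmetrized C = C.
Proof.
move=> Csym; apply: bifun01_ext => u v.
by rewrite symmetrizedE (Csym v u); lra.
Qed.

(** The rectangle [[0, u] x [v, 1]] has volume [u - C u v]. *)
Lemma copula_le_l C u v : is_copula C -> (C u v)%:num <= u%:num.
Proof.
case=> C0 C1 Cvol.
(* The volume axiom only covers nondegenerate rectangles, so [v = 1] and [u = 0] are settled by the
   boundary values. *)
have [v1|v1] := eqVneq v%:num 1.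
  by have -> : v = i1 by [exact/val_inj]; rewrite (C1 u u).2.
have [u0|u0] := eqVneq u%:num 0.
  by have -> : u = i0 by [exact/val_inj]; rewrite (C0 v v).1.
have u_gt0 : i0%:num < u%:num by rewrite lt_neqAle eq_sym u0 i01_ge0.
have v_lt1 : v%:num < i1%:num by rewrite lt_neqAle v1 i01_le1.
have := Cvol _ _ _ _ u_gt0 v_lt1.
by rewrite (C1 u v).2 (C0 u i1).1 (C0 u v).1 /=; lra.
Qed.

Lemma is_copula_transpose C : is_copula C -> is_copula (copula_transpose C).
Proof.
case=> C0 C1 Cvol; split=> [u v|u v|u1 u2 v1 v2 u12 v12].
- by rewrite /copula_transpose (C0 v v).2 (C0 u u).1.
- by rewrite /copula_transpose (C1 v v).2 (C1 u u).1.
- by have := Cvol _ _ _ _ v12 u12; rewrite /copula_transpose; lra.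
Qed.

Lemma copula_leM C u v : is_copula C -> (C u v)%:num <= (copula_M R u v)%:num.
Proof.
move=> Ccop; rewrite /= le_min copula_le_l //=.
exact/(copula_le_l v u (is_copula_transpose Ccop)).
Qed.

(** The rectangle [[u, 1] x [v, 1]] has volume [1 - u - v + C u v]. *)
Lemma copula_geW C u v : is_copula C -> (copula_W R u v)%:num <= (C u v)%:num.
Proof.
case=> C0 C1 Cvol; rewrite /= ge_max i01_ge0 andbT.
have [v1|v1] := eqVneq v%:num 1.
  by have -> : v = i1 by [exact/val_inj]; rewrite (C1 u u).2 /=; lra.
have [u1|u1] := eqVneq u%:num 1.
  by have -> : u = i1 by [exact/val_inj]; rewrite (C1 v v).1 /=; lra.
have u_lt1 : u%:num < i1%:num by rewrite lt_neqAle u1 i01_le1.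
have v_lt1 : v%:num < i1%:num by rewrite lt_neqAle v1 i01_le1.
have := Cvol _ _ _ _ u_lt1 v_lt1.
by rewrite (C1 u i1).1 (C1 u v).1 (C1 u v).2 /=; lra.
Qed.

Lemma is_copula_M : is_copula (copula_M R).
Proof.
split=> [u v|u v|u1 u2 v1 v2 /= u12 v12].
- by split; apply: val_inj => /=; [apply: min_l | apply: min_r].
- by split; apply: val_inj => /=; [apply: min_r | apply: min_l].
- by case: (leP u2%:num v2%:num); case: (leP u2%:num v1%:num);
    case: (leP u1%:num v2%:num); case: (leP u1%:num v1%:num); lra.
Qed.

Lemma is_copula_W : is_copula (copula_W R).
Proof.
split=> [u v|u v|u1 u2 v1 v2 /= u12 v12].
- have := i01_le1 u; have := i01_le1 v => v1 u1.
  by split; apply: val_inj; rewrite /= max_r //; lra.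
- have := i01_ge0 u; have := i01_ge0 v => v0 u0.
  by split; apply: val_inj; rewrite /= max_l; lra.
- by case: (leP (u2%:num + v2%:num - 1) 0);
    case: (leP (u2%:num + v1%:num - 1) 0);
    case: (leP (u1%:num + v2%:num - 1) 0);
    case: (leP (u1%:num + v1%:num - 1) 0); lra.
Qed.

Lemma symmetrized_M_inj C :
  is_copula C -> symmetrized C = copula_M R -> C = copula_M R.
Proof.
move=> Ccop CS; apply: bifun01_ext => u v.
have := copula_leM u v Ccop; have := copula_leM v u Ccop.
(* By symmetry of [min], [C u v] and [C v u] share one upper bound; their mean attains it, so both
   do. *)
have := symmetrizedE C u v; rewrite CS /= [Num.min v%:num _]minC.
lra.
Qed.

Lemma symmetrized_W_inj C :
  is_copula C -> symmetrized C = copula_W R -> C = copula_W R.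
Proof.
move=> Ccop CS; apply: bifun01_ext => u v.
have := copula_geW u v Ccop; have := copula_geW v u Ccop.
have := symmetrizedE C u v; rewrite CS /= [v%:num + _]addrC.
lra.
Qed.

(** Factored form of the perturbed product: [f x g y - g x f y = x y (1 - x) (1 - y) (y - x)]. *)
Definition skew_product (x y : R) : R :=
  x * y * (1 + (1 - x) * (1 - y) * (y - x) / 2).

Lemma skew_product_itv01 (x y : R) :
  0 <= x <= 1 -> 0 <= y <= 1 -> 0 <= skew_product x y <= 1.
Proof.
move=> /andP[x0 x1] /andP[y0 y1]; rewrite /skew_product.
have p0 : 0 <= (1 - x) * (1 - y) by rewrite mulr_ge0 ?subr_ge0.
have p1 : (1 - x) * (1 - y) <= 1 - x by rewrite ler_piMr; lra.
have q0 : - ((1 - x) * (1 - y)) <= (1 - x) * (1 - y) * (y - x).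
  by rewrite -mulrN1 ler_wpM2l; lra.
have q1 : (1 - x) * (1 - y) * (y - x) <= (1 - x) * (1 - y).
  by rewrite ler_piMr; lra.
have xy0 : 0 <= x * y by rewrite mulr_ge0.
have xyx : x * y <= x by rewrite ler_piMr.
apply/andP; split; first by rewrite mulr_ge0; lra.
(* The last factor is at most [1 + (1 - x) / 2 <= 2 - x], a bound that suffices because
   [x (2 - x) = 1 - (1 - x)^2]. *)
have le_xy : x * y * (1 + (1 - x) * (1 - y) * (y - x) / 2) <= x * y * (2 - x).
  by rewrite ler_wpM2l; lra.
have le_x : x * y * (2 - x) <= x * (2 - x) by rewrite ler_wpM2r; lra.
by have := sqr_ge0 (1 - x); rewrite expr2; lra.
Qed.

(* [1 - a - b] and [a + b - (a^2 + a b + b^2)] are the difference quotients of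
   [t (1 - t)] and [t^2 (1 - t)] between [a] and [b]. *)
Lemma skew_product_volume (x1 x2 y1 y2 : R) :
  skew_product x2 y2 - skew_product x2 y1 - skew_product x1 y2
    + skew_product x1 y1 =
  (x2 - x1) * (y2 - y1) *
    (1 + ((1 - x1 - x2) * (y1 + y2 - (y1 ^+ 2 + y1 * y2 + y2 ^+ 2))
          - (x1 + x2 - (x1 ^+ 2 + x1 * x2 + x2 ^+ 2)) * (1 - y1 - y2)) / 2).
Proof. by rewrite /skew_product; field. Qed.

Lemma quadratic_slope_norm (a b : R) :
  0 <= a <= 1 -> 0 <= b <= 1 -> `|1 - a - b| <= 1.
Proof. by move=> /andP[? ?] /andP[? ?]; rewrite ler_norml; apply/andP; split; lra. Qed.

(** The slope is [a (1 - a) + b (1 - b) - a b], where the first two terms lie in [[0, 1/4]] and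
    [a b] in [[0, 1]]. *)
Lemma cubic_slope_norm (a b : R) :
  0 <= a <= 1 -> 0 <= b <= 1 -> `|a + b - (a ^+ 2 + a * b + b ^+ 2)| <= 1.
Proof.
move=> /andP[a0 a1] /andP[b0 b1]; rewrite ler_norml; apply/andP; split; nra.
Qed.

(** Each product of slopes lies in [[-1, 1]], so their difference is at least [-2]; the coefficient
    [1/2] of the perturbation keeps the last factor of the volume nonnegative. *)
Lemma skew_product_volume_ge0 (x1 x2 y1 y2 : R) :
  0 <= x1 <= 1 -> 0 <= x2 <= 1 -> 0 <= y1 <= 1 -> 0 <= y2 <= 1 ->
  x1 <= x2 -> y1 <= y2 ->
  0 <= skew_product x2 y2 - skew_product x2 y1 - skew_product x1 y2
       + skew_product x1 y1.
Proof.
move=> x1I x2I y1I y2I x12 y12; rewrite skew_product_volume.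
have norm_mul_le1 (s t : R) : `|s| <= 1 -> `|t| <= 1 -> -1 <= s * t <= 1.
  by move=> s1 t1; rewrite -ler_norml normrM mulr_ile1.
have /andP[h1 _] := norm_mul_le1 _ _ (quadratic_slope_norm x1I x2I)
  (cubic_slope_norm y1I y2I).
have /andP[_ h2] := norm_mul_le1 _ _ (cubic_slope_norm x1I x2I)
  (quadratic_slope_norm y1I y2I).
by rewrite !mulr_ge0 ?subr_ge0 //; lra.
Qed.

Lemma i01_itv u : 0 <= u%:num <= 1.
Proof. by rewrite i01_ge0 i01_le1. Qed.

Definition skew_copula : bifun01 R := fun u v =>
  let uvI := andP (skew_product_itv01 (i01_itv u) (i01_itv v)) in
  Itv01 (proj1 uvI) (proj2 uvI).

Lemma skew_copulaE u v : (skew_copula u v)%:num = skew_product u%:num v%:num.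
Proof. by []. Qed.

Lemma is_copula_skew : is_copula skew_copula.
Proof.
split=> [u v|u v|u1 u2 v1 v2 u12 v12].
- by split; apply: val_inj; rewrite /= /skew_product; ring.
- by split; apply: val_inj; rewrite /= /skew_product; ring.
- by rewrite !skew_copulaE skew_product_volume_ge0 ?i01_itv ?ltW.
Qed.

(** Swapping the arguments only flips the sign of [y - x], so the perturbation cancels in the
    mean. *)
Lemma symmetrized_skew : symmetrized skew_copula = copula_Pi R.
Proof.
apply: bifun01_ext => u v.
by rewrite symmetrizedE !skew_copulaE /= /skew_product; field.
Qed.

Lemma skew_copula_neq_Pi : skew_copula <> copula_Pi R.
Proof.
(* The perturbation vanishes only on the boundary and the diagonal of the square; [(1/2, 1/4)]
   avoids both. *)
have h0 : 0 <= 2^-1 :> R by lra.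
have h1 : 2^-1 <= 1 :> R by lra.
have q0 : 0 <= 4^-1 :> R by lra.
have q1 : 4^-1 <= 1 :> R by lra.
move=> /(congr1 (fun C : bifun01 R => (C (Itv01 h0 h1) (Itv01 q0 q1))%:num)).
by rewrite skew_copulaE /= /skew_product; lra.
Qed.

End Copula.

Theorem proposition11 (R : realType) :
  unique (fun C : bifun01 R =>
            is_copula C /\ symmetrized C = copula_M R)
         (copula_M R) /\
  unique (fun C : bifun01 R =>
            is_copula C /\ symmetrized C = copula_W R)
         (copula_W R) /\
  (exists C : bifun01 R,
      is_copula C /\ C <> copula_Pi R /\ symmetrized C = copula_Pi R).
Proof.
split; [|split].
- split=> [|C [Ccop CS]]; last by rewrite (symmetrized_M_inj Ccop CS).
  split; first exact: is_copula_M.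
  by apply: symmetrized_sym => u v; apply: val_inj; rewrite /= minC.
- split=> [|C [Ccop CS]]; last by rewrite (symmetrized_W_inj Ccop CS).
  split; first exact: is_copula_W.
  by apply: symmetrized_sym => u v; apply: val_inj; rewrite /= [u%:num + _]addrC.
- exists (@skew_copula R).
  by split; [exact: is_copula_skew | split;
    [exact: skew_copula_neq_Pi | exact: symmetrized_skew]].
Qed.
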